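(* Let $B$ be a Ferrers board with $n$ columns, padded with columns of height zero on the left so that its root vector $\xi(B)=\langle z_1,\ldots,z_n\rangle$ has only non-negative entries. For each integer $k$ let $v_k$ be the number of entries of $\xi(B)$ equal to $k$, and let $M$ be the greatest integer with $v_M\neq 0$. Then the rook equivalence graph $G(B)$ is connected if and only if, for every $0\le i<M-1$, $v_i>1$ implies $v_{i+1}>1$.
   Context: A Ferrers board is given by a weakly increasing sequence of non-negative integers $B=(b_1,\ldots,b_n)$ of column heights; it is the set of unit cells in the first quadrant lying in column $i$ and rows $1,\ldots,b_i$. Prepending columns of height $0$ on the left does not change the board, and boards are compared using the same number of columns by such padding. A placement of $k$ rooks on $B$ is a set of $k$ cells of $B$ no two in the same row or column; $r_k(B)$ is the number of such placements. Two boards are rook equivalent if they have equal $r_k$ for all $k\ge 0$. The root vector of $B$ is $\xi(B)=\langle 0-b_1,1-b_2,\ldots,(n-1)-b_n\rangle$. The rook equivalence graph $G(B)$ has as vertices all Ferrers boards rook equivalent to $B$, and $\{B_1,B_2\}$ is an edge iff, written with the same number of columns, $B_1$ and $B_2$ differ in exactly two columns $i$ and $j$, where $B_1$ has $k$ more cells than $B_2$ in column $i$ and $k$ fewer cells than $B_2$ in column $j$, for some $k>0$. *)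

(* Defs.v *)
From mathcomp Require Import all_boot all_order all_algebra.
From Stdlib Require Import Relations.
Set Implicit Arguments. Unset Strict Implicit. Unset Printing Implicit Defensive.
Import Order.TTheory GRing.Theory Num.Theory.

(* A Ferrers board is a weakly increasing sequence of column heights.
   Column i (0-indexed) contains the cells in rows 0 .. b_i - 1. *)
Definition ferrers (b : seq nat) : bool := sorted leq b.

(* Canonical representative of a board modulo leading zero columns:
   all column heights positive. *)
Definition canonical (b : seq nat) : bool := ferrers b && all (fun x => 0 < x) b.

Definition pad (N : nat) (b : seq nat) : seq nat := nseq (N - size b) 0 ++ b.

(* r_k(B): number of sets of k cells of B, no two in the same row or column.
   Cells are pairs (column, row); rows are bounded by sumn b. *)
Definition rook_number (k : nat) (b : seq nat) : nat :=
  #|[set P : {set 'I_(size b) * 'I_(sumn b)} |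
      [&& #|P| == k,
          [forall x in P, (nat_of_ord x.2 < nth 0 b x.1)%N] &
          [forall x in P, forall y in P,
             ((x.1 == y.1) || (x.2 == y.2)) ==> (x == y)]]]|.

Definition rook_equiv (b1 b2 : seq nat) : Prop :=
  forall k, rook_number k b1 = rook_number k b2.

Definition rook_edge (b1 b2 : seq nat) : Prop :=
  let N := maxn (size b1) (size b2) in
  let p1 := pad N b1 in let p2 := pad N b2 in
  exists i j k : nat,
    [/\ (i < N)%N, (j < N)%N, i != j, (0 < k)%N &
     [/\ nth 0 p1 i = nth 0 p2 i + k, nth 0 p1 j + k = nth 0 p2 j &
         forall l, (l < N)%N -> l != i -> l != j -> nth 0 p1 l = nth 0 p2 l]].

(* Vertices of G(B): Ferrers boards (taken modulo leading zero columns,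
   i.e. canonical representatives) rook equivalent to B. *)
Definition GB_vertex (B c : seq nat) : Prop := canonical c /\ rook_equiv c B.

Definition GB_connected (B : seq nat) : Prop :=
  forall c1 c2, GB_vertex B c1 -> GB_vertex B c2 ->
    clos_refl_trans (seq nat)
      (fun x y => [/\ GB_vertex B x, GB_vertex B y & rook_edge x y]) c1 c2.

Definition root_vector (b : seq nat) : seq int :=
  [seq ((i%:Z) - (nth 0 b i)%:Z)%R | i <- iota 0 (size b)].

Definition root_mult (b : seq nat) (k : int) : nat := count_mem k (root_vector b).

(* Main.v *)
Require Import Defs.
From mathcomp Require Import all_boot all_order all_algebra.
From mathcomp Require Import zify ring.
From Stdlib Require Import Relations.

(* Removing the last (tallest) column gives the recurrence
   r_(k+1)(b h) = r_(k+1)(b) + (h - k) r_k(b), hence the Goldman-Joichi-White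
   factorization of the rook polynomial in falling factorials, and rook
   equivalence means having the same multiset of roots.  The vertices of G(B)
   are thus the words w with w_0 = 0 and w_(i+1) <= w_i + 1 on the letters of
   the root vector of B, and its edges are the transpositions between words.

   If the condition holds, exchange w_(p+1) < w_q <= w_p + 1 for p+1 < q, as
   long as this yields a word.  The moment sum i w_i decreases, so this stops;
   then the letters after the first M are weakly decreasing, the condition
   forces the letters before it to be distinct, and so the final word must be
   0 1 ... M-1 followed by the other letters in decreasing order.

   If i violates the condition, the letter i+1 < M is unique and no edge moves
   it, but 0 1 ... M ... and 0 1 ... i i i+1 ... M ... have it at different
   places. *)

Import Order.TTheory GRing.Theory Num.Theory.

Set Implicit Arguments. Unset Strict Implicit. Unset Printing Implicit Defensive.

(** * Rook numbers *)

Definition nonattacking (I J : finType) (P : {set I * J}) : bool :=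
  [forall x in P, forall y in P,
     ((x.1 == y.1) || (x.2 == y.2)) ==> (x == y)].

(** Stated for arbitrary finite types, since the row bound [sumn b] in [rook_number] changes when a
    column is added. *)
Definition placements (I J : finType) (A : {set I * J}) (k : nat) :=
  [set P : {set I * J} | [&& #|P| == k, P \subset A & nonattacking P]].

Lemma nonattackingP (I J : finType) (P : {set I * J}) :
  reflect {in P &, forall x y, x.1 = y.1 \/ x.2 = y.2 -> x = y}
          (nonattacking P).
Proof.
apply: (iffP forall_inP) => H x; last first.
  move=> Px; apply/forall_inP => y Py; apply/implyP => xy; apply/eqP/H => //.
  by case/orP: xy => /eqP; [left|right].
move=> y Px Py xy; have /forall_inP/(_ y Py)/implyP Hy := H x Px.
by apply/eqP/Hy; case: xy => ->; rewrite eqxx ?orbT.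
Qed.

Lemma nonattackingS (I J : finType) (P Q : {set I * J}) :
  P \subset Q -> nonattacking Q -> nonattacking P.
Proof.
move=> /subsetP sPQ /nonattackingP nQ; apply/nonattackingP => x y Px Py.
by apply: nQ; apply: sPQ.
Qed.

Lemma card_placements0 (I J : finType) (A : {set I * J}) :
  #|placements A 0| = 1.
Proof.
rewrite -(cards1 (@set0 (I * J)%type)); apply: eq_card => P.
rewrite !inE cards_eq0; case: eqP => //= ->; rewrite sub0set /=.
by apply/nonattackingP => x y; rewrite inE.
Qed.

Lemma card_placements_imset (I I' J J' : finType) (f : I -> I') (g : J -> J')
    (A : {set I * J}) (k : nat) :
  injective f -> injective g ->
  #|placements [set (f x.1, g x.2) | x in A] k| = #|placements A k|.
Proof.
move=> injf injg; set h := fun x : I * J => (f x.1, g x.2).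
have injh : injective h by move=> [a b] [c d] [/injf-> /injg->].
have nh (P : {set I * J}) : nonattacking [set h x | x in P] = nonattacking P.
  apply/nonattackingP/nonattackingP => H x y.
    move=> Px Py xy; apply/injh/H; rewrite ?imset_f //.
    by case: xy => /= ->; [left|right].
  move=> /imsetP[u Pu ->] /imsetP[v Pv ->] /= uv; congr h; apply: H => //.
  by case: uv => [/injf|/injg]; [left|right].
rewrite -(card_imset _ (imset_inj injh)); apply: eq_card => P.
rewrite !inE; apply/idP/imsetP => [/and3P[/eqP cP sP nP]|[Q]].
  have defP : P = [set h x | x in h @^-1: P].
    apply/setP => y; apply/idP/imsetP => [Py|[x]]; last by rewrite inE => Px ->.
    by have /imsetP[x Ax xy] := subsetP sP y Py; exists x; rewrite // inE -xy.
  exists (h @^-1: P) => //; rewrite inE -nh -defP nP andbT.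
  rewrite -(card_imset _ injh) -defP cP eqxx /=.
  apply/subsetP => x; rewrite inE => /(subsetP sP) /imsetP[y Ay xy].
  by rewrite (injh x y xy).
rewrite inE => /and3P[cQ sQ nQ] ->; rewrite nh nQ andbT card_imset // cQ /=.
exact: imsetS.
Qed.

(** A placement either avoids column [i0] or consists of [k] rooks on [A] and one rook of column
    [i0] in a row they leave free; those [k] rooks occupy [k] distinct rows of [S]. *)
Lemma card_placementsU (I J : finType) (A : {set I * J}) (i0 : I) (S : {set J})
    (k : nat) :
  {in A, forall x, x.1 != i0 /\ x.2 \in S} ->
  #|placements (A :|: setX [set i0] S) k.+1| =
    #|placements A k.+1| + (#|S| - k) * #|placements A k|.
Proof.
move=> hA; set A' := A :|: _.
pose rows (P : {set I * J}) := [set x.2 | x in P].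
(* [U] pairs a placement on [A] with a free row; [add] puts the extra rook there. *)
pose U := [set u : {set I * J} * J |
            (u.1 \in placements A k) && (u.2 \in S :\: rows u.1)].
pose add (u : {set I * J} * J) := (i0, u.2) |: u.1.
have i0A (P : {set I * J}) j : P \subset A -> (i0, j) \notin P.
  by move=> /subsetP sP; apply/negP => /sP /hA[]; rewrite eqxx.
have cU : #|U| = (#|S| - k) * #|placements A k|.
  rewrite -sum1_card mulnC -sum_nat_const.
  rewrite (eq_bigl (fun u => (u.1 \in placements A k) &&
      (u.2 \in S :\: rows u.1))); last by move=> u; rewrite /U inE.
  rewrite -(pair_big_dep (fun P => P \in placements A k)
    (fun P j => j \in S :\: rows P) (fun _ _ => 1)) /=.
  apply: eq_bigr => P; rewrite inE => /and3P[/eqP cP sP /nonattackingP nP].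
  rewrite sum1_card cardsD (setIidPr _); last first.
    by apply/subsetP => j /imsetP[x /(subsetP sP) /hA[_ Sx] ->].
  by rewrite card_in_imset ?cP // => x y Px Py xy; apply: nP => //; right.
have injadd : {in U &, injective add}.
  move=> [P i] [Q j]; rewrite !inE /= => /andP[/and3P[_ sP _] _].
  move=> /andP[/and3P[_ sQ _] _] PQ.
  have ij : i = j.
    have: (i0, i) \in add (Q, j) by rewrite -PQ setU11.
    by rewrite !inE (negPf (i0A _ _ sQ)) orbF => /eqP[].
  congr pair => //; rewrite -(setU1K (i0A _ i sP)) -(setU1K (i0A _ j sQ)).
  by rewrite -ij -/(add (P, i)) PQ ij.
rewrite -cU -(card_in_imset injadd) -cardsUI.
rewrite (_ : _ :&: _ = set0) ?cards0 ?addn0; last first.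
  apply/setP => P; rewrite in_set0 in_setI; apply/negP => /andP[].
  rewrite inE => /and3P[_ sP _] /imsetP[u _ defP].
  by have := i0A _ u.2 sP; rewrite defP setU11.
apply: eq_card => P; rewrite in_setU [in LHS]inE; apply/and3P/orP.
  move=> [/eqP cP sP nP]; case: (boolP [exists j, (i0, j) \in P]); last first.
    rewrite negb_exists => /forallP i0P; left; rewrite inE cP eqxx nP andbT /=.
    apply/subsetP => -[i j] Pij; have := subsetP sP _ Pij.
    rewrite !inE /= => /orP[] // /andP[/eqP i0i _].
    by have := i0P j; rewrite -i0i Pij.
  move=> /existsP[j Pj]; right; apply/imsetP; exists (P :\ (i0, j), j); last first.
    by rewrite /add /= setD1K.
  have nP' := elimT (nonattackingP _) nP.
  rewrite inE /= !inE; apply/andP; split; [apply/and3P; split|apply/andP; split].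
  - by move: cP; rewrite (cardsD1 (i0, j)) Pj add1n => -[->].
  - apply/subsetP => x; rewrite !inE => /andP[neqx Px].
    have := subsetP sP x Px; rewrite !inE => /orP[] // /andP[/eqP i0x _].
    by case/negP: neqx; apply/eqP; apply: nP' => //=; left.
  - by apply: nonattackingS nP; apply: subsetDl.
  - apply/negP => /imsetP[x]; rewrite !inE => /andP[neqx Px] /= jx.
    by case/negP: neqx; apply/eqP; apply: nP' => //=; right.
  - have := subsetP sP _ Pj; rewrite !inE /= eqxx => /orP[/hA[]|] //.
case=> [|/imsetP[[Q j]]].
  rewrite inE => /and3P[cP sP nP]; split=> //.
  exact: subset_trans sP (subsetUl _ _).
rewrite !inE /= => /andP[/and3P[/eqP cQ sQ /nonattackingP nQ] /andP[jQ jS]] ->.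
rewrite cardsU1 i0A // cQ; split=> //.
  apply/subsetP => x; rewrite !inE => /orP[/eqP->|/(subsetP sQ)->] //=.
  by rewrite eqxx jS orbT.
have nj x : x \in Q -> x.1 = i0 \/ x.2 = j -> False.
  move=> Qx [xi|xj]; first by have := hA x (subsetP sQ _ Qx); rewrite xi eqxx => -[].
  by case/negP: jQ; rewrite -xj; apply: imset_f.
apply/nonattackingP => x y; rewrite !inE.
move=> /orP[/eqP->|Qx] /orP[/eqP->|Qy] //= xy.
- by case: (nj y Qy); case: xy; [left|right].
- by case: (nj x Qx).
exact: nQ.
Qed.

(** * Rook numbers of a board, column by column *)

Definition cells (m n : nat) (b : seq nat) : {set 'I_m * 'I_n} :=
  [set x : 'I_m * 'I_n | x.2 < nth 0 b x.1].

Lemma rook_numberE (k : nat) (b : seq nat) :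
  rook_number k b = #|placements (cells (size b) (sumn b) b) k|.
Proof.
apply: eq_card => P; rewrite !inE; congr [&& _, _ & _].
apply/'forall_implyP/subsetP => H x /H; by rewrite inE.
Qed.

Lemma rook_number0 (b : seq nat) : rook_number 0 b = 1.
Proof. by rewrite rook_numberE card_placements0. Qed.

Lemma rook_numberS_nil (k : nat) : rook_number k.+1 [::] = 0.
Proof.
apply: eq_card0 => P; rewrite !inE; apply/negP => /and3P[/eqP cP _ _].
have /card_gt0P[[[]]] // : 0 < #|P| by rewrite cP.
Qed.

Lemma leq_nth_sumn (b : seq nat) (i : nat) : nth 0 b i <= sumn b.
Proof. by elim: b i => [|x b IH] [|i] //=; rewrite ?leq_addr // (leq_trans (IH i)) ?leq_addl. Qed.

Lemma ferrers_rcons (b : seq nat) (h : nat) :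
  ferrers (rcons b h) -> ferrers b /\ forall i, nth 0 b i <= h.
Proof.
rewrite /ferrers => sb; split; first by rewrite (subseq_sorted leq_trans _ sb) ?subseq_rcons.
move=> i; case: (ltnP i (size b)) => ib; last by rewrite nth_default.
have := sorted_leq_nth leq_trans leqnn 0 sb i (size b).
by rewrite !inE size_rcons !nth_rcons ltnn eqxx ib ltnS (ltnW ib) leqnn; apply.
Qed.

(* The last column is the tallest, so the rooks standing on the other columns
   each forbid one of its cells. *)
Lemma rook_numberS_rcons (k : nat) (b : seq nat) (h : nat) :
  ferrers (rcons b h) ->
  rook_number k.+1 (rcons b h) =
    rook_number k.+1 b + (h - k) * rook_number k b.
Proof.
move=> /ferrers_rcons[_ bh].
have le1 : size b <= size (rcons b h) by rewrite size_rcons.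
have le2 : sumn b <= sumn (rcons b h) by rewrite sumn_rcons leq_addr.
have lth : size b < size (rcons b h) by rewrite size_rcons.
pose A := [set (widen_ord le1 x.1, widen_ord le2 x.2)
            | x in cells (size b) (sumn b) b].
pose S := [set j : 'I_(sumn (rcons b h)) | j < h].
have cS : #|S| = h.
  rewrite -sum1_card (eq_bigl (fun j : 'I_(sumn (rcons b h)) => j < h)); last first.
    by move=> j; rewrite inE.
  rewrite (big_ord_narrow (F := fun=> 1)) ?sum1_card ?card_ord //.
  by rewrite sumn_rcons leq_addl.
rewrite !rook_numberE.
rewrite (_ : cells _ _ (rcons b h) = A :|: setX [set Ordinal lth] S).
  rewrite card_placementsU ?cS.
    have wi m n (le : m <= n) : injective (widen_ord le).
      by move=> x y /(congr1 val) /= xy; apply: val_inj.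
    by rewrite !card_placements_imset //; apply: wi.
  move=> x /imsetP[[i j]]; rewrite inE /= => ij -> /=; split.
    by rewrite -val_eqE /= neq_ltn ltn_ord.
  by rewrite inE /= (leq_trans ij).
apply/setP => -[i j]; rewrite !inE /= nth_rcons -val_eqE /=.
have [ib|ib|ib] := ltngtP i (size b); last first.
- rewrite orbC; case: ltnP => //= hj.
  apply/esym/imsetP => -[[i' j']] _ [] /(congr1 val) /= ii _.
  by have := ltn_ord i'; rewrite -ii ib ltnn.
- by have := ltn_ord i; rewrite {2}size_rcons ltnS leqNgt ib.
rewrite orbF; apply/idP/imsetP => [jb|[[i' j']]].
  exists (Ordinal ib, Ordinal (leq_trans jb (leq_nth_sumn _ _))); rewrite ?inE //=.
  by congr pair; apply: val_inj.
by rewrite inE /= => ij [/(congr1 val) /= -> /(congr1 val) /= ->].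
Qed.

Lemma rook_number_gt_size (k : nat) (b : seq nat) :
  ferrers b -> size b < k -> rook_number k b = 0.
Proof.
elim/last_ind: b k => [|b h IH] [|k] // fb; first by rewrite rook_numberS_nil.
have [fb' _] := ferrers_rcons fb.
by rewrite size_rcons ltnS rook_numberS_rcons // => lt; rewrite !IH ?muln0 // ltnW.
Qed.

(** Lets the truncated factor [h - k] of the recurrence be read as a difference of rationals: when
    [h < k], its cofactor [rook_number k b] vanishes. *)
Lemma rook_number_gt_height (k : nat) (b : seq nat) (h : nat) :
  ferrers b -> (forall i, nth 0 b i <= h) -> h < k -> rook_number k b = 0.
Proof.
elim/last_ind: b k => [|b x IH] [|k] // fb bh; first by rewrite rook_numberS_nil.
have [fb' bx] := ferrers_rcons fb.
have xh : x <= h by have := bh (size b); rewrite nth_rcons ltnn eqxx.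
rewrite ltnS rook_numberS_rcons // => lt.
have -> : x - k = 0 by apply/eqP; rewrite subn_eq0; apply: leq_trans lt.
by rewrite IH // => i; apply: leq_trans (bx i) xh.
Qed.

Lemma rook_number_cons0 (k : nat) (b : seq nat) :
  ferrers b -> rook_number k (0 :: b) = rook_number k b.
Proof.
elim/last_ind: b k => [|b h IH] [|k] // fb; rewrite ?rook_number0 //.
  by rewrite (@rook_numberS_rcons k [::] 0) // rook_numberS_nil.
have [fb' _] := ferrers_rcons fb.
have fb0 : ferrers (0 :: rcons b h).
  by move: fb; rewrite /ferrers; case: (b).
by rewrite rook_numberS_rcons // -rcons_cons rook_numberS_rcons // !IH.
Qed.

Lemma ferrers_nseq0 (m : nat) (b : seq nat) : ferrers b -> ferrers (nseq m 0 ++ b).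
Proof.
by move=> fb; elim: m => //= -[|m] //= _; move: fb; rewrite /ferrers; case: (b).
Qed.

Lemma rook_number_nseq0 (k m : nat) (b : seq nat) :
  ferrers b -> rook_number k (nseq m 0 ++ b) = rook_number k b.
Proof.
by move=> fb; elim: m => //= m <-; rewrite rook_number_cons0 // ferrers_nseq0.
Qed.

(** * The Goldman-Joichi-White factorization *)

Local Open Scope ring_scope.

Definition falling (m : nat) : {poly rat} := \prod_(i < m) ('X - i%:R%:P).

Lemma size_root_vector (b : seq nat) : size (root_vector b) = size b.
Proof. by rewrite size_map size_iota. Qed.

Lemma nth_root_vector (b : seq nat) (i : nat) :
  (i < size b)%N -> nth 0 (root_vector b) i = i%:Z - (nth 0%N b i)%:Z.
Proof. by move=> ib; rewrite (nth_map 0%N) ?size_iota // nth_iota. Qed.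

Lemma root_vector_rcons (b : seq nat) (h : nat) :
  root_vector (rcons b h) = rcons (root_vector b) ((size b)%:Z - h%:Z).
Proof.
rewrite /root_vector size_rcons -addn1 iotaD map_cat -[RHS]cats1 /= add0n nth_rcons ltnn eqxx.
congr (_ ++ _); apply/eq_in_map => i; rewrite mem_iota /= => ib.
by rewrite nth_rcons ib.
Qed.

(** The inductive step rests on X - (n - h) = (X - (n - k)) + (h - k): multiplied by
    [falling (n - k)], this gives [falling (n.+1 - k)] plus [h - k] times [falling (n - k)]. *)
Lemma rook_factorization (b : seq nat) :
  ferrers b ->
  \sum_(k < (size b).+1) (rook_number k b)%:R *: falling (size b - k) =
  \prod_(z <- root_vector b) ('X - z%:~R%:P).
Proof.
elim/last_ind: b => [_|b h IH fb].
  by rewrite big_ord1 rook_number0 big_nil scale1r /falling big_ord0.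
have [fb' bh] := ferrers_rcons fb.
rewrite root_vector_rcons -[rcons (root_vector b) _]cats1 big_cat big_seq1 /= -(IH fb') size_rcons.
set n := size b.
rewrite big_ord_recl rook_number0 scale1r subn0.
under eq_bigr => i _ do
  rewrite lift0 rook_numberS_rcons // natrD scalerDl subSS.
rewrite big_split /= addrA.
(* An index shift absorbs the leading term; the last term on the left drops out because r_(n+1)(b) =
   0. *)
have -> : falling n.+1 +
    \sum_(i < n.+1) (rook_number i.+1 b)%:R *: falling (n - i) =
    \sum_(i < n.+1) (rook_number i b)%:R *: falling (n.+1 - i).
  rewrite [RHS]big_ord_recl rook_number0 scale1r subn0 big_ord_recr /=.
  by rewrite (rook_number_gt_size fb') // scale0r addr0.
rewrite mulr_suml -big_split /=; apply: eq_bigr => i _.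
have le_in : (i <= n)%N by rewrite -ltnS.
rewrite subSn // /falling big_ord_recr /= -/(falling _).
have -> : ((h - i) * rook_number i b)%:R = (h%:R - i%:R) * (rook_number i b)%:R :> rat.
  case: (leqP i h) => hi; first by rewrite natrM natrB.
  by rewrite (rook_number_gt_height fb' bh hi) muln0 mulr0.
rewrite -!mul_polyC natrB // rmorphB /= !polyCM !polyCB.
ring.
Qed.

Lemma falling_horner_lt (m j : nat) : (j < m)%N -> (falling m).[j%:R] = 0.
Proof.
move=> jm; rewrite horner_prod (bigD1 (Ordinal jm)) //=.
by rewrite hornerXsubC subrr mul0r.
Qed.

Lemma falling_horner_neq0 (j : nat) : (falling j).[j%:R] != 0.
Proof.
rewrite horner_prod; apply/prodf_neq0 => i _.
by rewrite hornerXsubC subr_eq0 eqr_nat neq_ltn ltn_ord orbT.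
Qed.

(** Evaluation at [m] kills every later falling factorial but not [falling m], so the coefficients
    vanish one after another. *)
Lemma falling_free (n : nat) (c : nat -> rat) :
  \sum_(m < n) c m *: falling m = 0 -> forall m, (m < n)%N -> c m = 0.
Proof.
move=> sum0; elim/ltn_ind=> m IH mn.
have /(congr1 (horner_eval m%:R)) := sum0.
rewrite /horner_eval horner_sum (bigD1 (Ordinal mn)) //= horner0 hornerZ.
rewrite big1 ?addr0 => [/eqP|i ne].
  by rewrite mulf_eq0 (negPf (falling_horner_neq0 m)) orbF => /eqP.
rewrite hornerZ; case: (ltnP i m) => im; first by rewrite IH ?mul0r.
rewrite falling_horner_lt ?mulr0 // ltn_neqAle im andbT.
by rewrite eq_sym.
Qed.

(** One direction is unique factorization into linear factors, the other linear independence of the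
    falling factorials; equal sizes make both expansions use the same ones. *)
Lemma rook_equiv_root_vector (b1 b2 : seq nat) :
  ferrers b1 -> ferrers b2 -> size b1 = size b2 ->
  rook_equiv b1 b2 <-> perm_eq (root_vector b1) (root_vector b2).
Proof.
move=> f1 f2 eqs; split=> [req|].
  have := rook_factorization f1; rewrite (eq_bigr (fun k : 'I_(size b1).+1 =>
    (rook_number k b2)%:R *: falling (size b1 - k))); last by move=> k _; rewrite req.
  rewrite eqs (rook_factorization f2) => E.
  apply: (perm_map_inj (intr_inj (R := rat))); apply: prod_XsubC_eq.
  by move: E; move: (root_vector b1) (root_vector b2) => r1 r2 E; rewrite !big_map.
move=> peq k; case: (ltnP (size b1) k) => [lt|le].
  by rewrite !rook_number_gt_size // -eqs.
have := rook_factorization f1.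
rewrite (perm_big _ peq) -rook_factorization //= -eqs => /eqP.
rewrite -subr_eq0 -sumrB (reindex_inj rev_ord_inj) /= => /eqP sum0.
pose c m := (rook_number (size b1 - m) b1)%:R - (rook_number (size b1 - m) b2)%:R : rat.
have := @falling_free (size b1).+1 c.
have -> : \sum_(m < (size b1).+1) c m *: falling m = 0.
  rewrite -[RHS]sum0; apply: eq_bigr => i _; rewrite -scalerBl subSS.
  by rewrite subKn // -ltnS.
move=> /(_ erefl (size b1 - k)%N); rewrite ltnS leq_subr /c subKn // => /(_ isT).
by move/eqP; rewrite subr_eq0 eqr_nat => /eqP.
Qed.
Local Close Scope ring_scope.

(** * Words of non-negative root vectors *)

(* The default value 0 of [nth] makes the growth condition harmless past the
   end of [w]. *)
Definition word (w : seq nat) : Prop :=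
  nth 0 w 0 = 0 /\ forall i, nth 0 w i.+1 <= (nth 0 w i).+1.

Lemma word_leq (w : seq nat) (i : nat) : word w -> nth 0 w i <= i.
Proof. by move=> [w0 wS]; elim: i => [|i IH]; rewrite ?w0 // (leq_trans (wS i)). Qed.

(** Letters start at 0 and rise by at most one per step, so every value below [nth 0 w s] is met;
    [t] is its last visit before [s]. *)
Lemma word_last_visit (w : seq nat) (c s : nat) :
  word w -> c < nth 0 w s ->
  exists t, [/\ t < s, nth 0 w t = c & forall r, t < r <= s -> c < nth 0 w r].
Proof.
move=> [w0 wS]; elim: s => [|s IH] ws; first by rewrite w0 in ws.
case: (ltnP c (nth 0 w s)) => [/IH[t [ts wt wr]]|le].
  exists t; split=> //; first by apply: ltnW.
  by move=> r /andP[tr]; rewrite leq_eqVlt => /orP[/eqP->//|rs]; rewrite wr // tr.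
exists s; split=> // [|r sr]; first by have := wS s; lia.
by have -> : r = s.+1 by lia.
Qed.

Lemma word_mem_leq (w : seq nat) (c m : nat) :
  word w -> m \in w -> c <= m -> c \in w.
Proof.
move=> ww mw; rewrite leq_eqVlt => /orP[/eqP->//|cm].
have sm : index m w < size w by rewrite index_mem.
have [|t [ts <- _]] := @word_last_visit w c (index m w) ww; first by rewrite nth_index.
by rewrite mem_nth // (ltn_trans ts).
Qed.

(** The default letter 0 past the end forces a descent to at most [y]. *)
Lemma last_gt (w : seq nat) (y t : nat) :
  y < nth 0 w t ->
  exists q, [/\ t <= q, y < nth 0 w q & nth 0 w q.+1 <= y].
Proof.
have [m] := ubnP (size w - t); elim: m t => // m IH t lt yt.
have tw : t < size w by rewrite ltnNge; apply/negP => le; rewrite nth_default in yt.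
case: (leqP (nth 0 w t.+1) y) => [le|/IH[|q [tq yq qy]]]; first by exists t.
  by lia.
by exists q; split=> //; apply: ltnW.
Qed.

Lemma count_mem_gt1P (T : eqType) (x0 x : T) (w : seq T) :
  1 < count_mem x w <->
  exists p q, [/\ p < q, q < size w, nth x0 w p = x & nth x0 w q = x].
Proof.
split.
  elim: w => //= y w IH; case: eqP => [->|_]; last first.
    by rewrite add0n => /IH[p [q [pq qw <- wq]]]; exists p.+1, q.+1.
  rewrite add1n ltnS -has_count has_pred1 => xw.
  by exists 0, (index x w).+1; split; rewrite //= ?ltnS ?index_mem ?nth_index.
move=> [p [q [pq qw wp wq]]]; rewrite -(cat_take_drop q w) count_cat.
have h1 : 0 < count_mem x (take q w).
  rewrite -has_count has_pred1 -wp -(nth_take _ pq) mem_nth // size_take qw //.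
suff: 0 < count_mem x (drop q w) by lia.
by rewrite -has_count has_pred1 (drop_nth x0) // wq in_cons eqxx.
Qed.

(** * Exchanging two letters of a word *)

Definition transp (p q i : nat) : nat :=
  if i == p then q else if i == q then p else i.

Lemma transpL (p q : nat) : transp p q p = q.
Proof. by rewrite /transp eqxx. Qed.

Lemma transpR (p q : nat) : transp p q q = p.
Proof. by rewrite /transp eqxx; case: eqP. Qed.

Lemma transpD (p q i : nat) : i <> p -> i <> q -> transp p q i = i.
Proof. by rewrite /transp => /eqP/negPf-> /eqP/negPf->. Qed.

Lemma transpK (p q : nat) : involutive (transp p q).
Proof.
move=> i; rewrite /transp; have [->|ip] := eqVneq i p; first by rewrite eqxx; case: eqP.
have [->|iq] := eqVneq i q; first by rewrite eqxx.
by rewrite (negPf ip) (negPf iq).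
Qed.

Lemma transp_lt (n p q i : nat) : p < n -> q < n -> (transp p q i < n) = (i < n).
Proof.
move=> pn qn; rewrite /transp; have [->|_] := eqVneq i p; first by rewrite pn qn.
by have [->|//] := eqVneq i q; rewrite pn qn.
Qed.

Definition swap (p q : nat) (w : seq nat) : seq nat :=
  mkseq (fun i => nth 0 w (transp p q i)) (size w).

Lemma size_swap (p q : nat) (w : seq nat) : size (swap p q w) = size w.
Proof. exact: size_mkseq. Qed.

Lemma nth_swap (p q : nat) (w : seq nat) (i : nat) :
  p < size w -> q < size w -> nth 0 (swap p q w) i = nth 0 w (transp p q i).
Proof.
move=> pw qw; case: (ltnP i (size w)) => iw; first by rewrite nth_mkseq.
by rewrite !nth_default ?size_swap // leqNgt transp_lt // -leqNgt.
Qed.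

Lemma perm_swap (p q : nat) (w : seq nat) :
  p < size w -> q < size w -> perm_eq (swap p q w) w.
Proof.
move=> pw qw; rewrite -[X in perm_eq _ X](take_size w) -(map_nth_iota0 0) //.
rewrite /swap /mkseq (map_comp (nth 0 w) (transp p q)).
apply: perm_map; have injT := inv_inj (@transpK p q).
have memT i : i \in iota 0 (size w) -> transp p q i \in iota 0 (size w).
  by rewrite !mem_iota /= !add0n transp_lt.
apply: uniq_perm; rewrite ?map_inj_uniq ?iota_uniq // => i.
apply/mapP/idP => [[j /memT jw ->] //|iw].
by exists (transp p q i); rewrite ?memT ?transpK.
Qed.

(** The last two conditions are the growth steps into [p.+1] and out of [q] after the exchange; the
    other two affected steps only get easier. Position 0 is never touched. *)
Definition raisable (w : seq nat) (p q : nat) : bool :=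
  [&& p.+1 < q, q < size w, nth 0 w p.+1 < nth 0 w q,
      nth 0 w q <= (nth 0 w p).+1 & nth 0 w q.+1 <= (nth 0 w p.+1).+1].

Lemma word_raise (w : seq nat) (p q : nat) :
  word w -> raisable w p q -> word (swap p.+1 q w).
Proof.
move=> [w0 wS] /and5P[pq qw lt1 le2 le3].
have pw : p.+1 < size w by apply: ltn_trans qw.
split=> [|i]; rewrite !nth_swap //.
  by rewrite transpD ?w0 // => q0; rewrite -q0 in pq.
case: (i =P p) => [->|ip]; first by rewrite transpL transpD //; lia.
have Hi := wS i; case: (i =P p.+1) => [e|e].
  subst i; rewrite transpL; case: (p.+2 =P q) => [e|ne]; first by subst q; rewrite transpR; lia.
  by rewrite transpD; lia.
case: (i.+1 =P q) => [e1|e1].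
  by subst q; rewrite transpR transpD; lia.
case: (i =P q) => [e2|e2]; first by subst i; rewrite transpR transpD; lia.
by rewrite !transpD; lia.
Qed.

Definition moment (w : seq nat) : nat := \sum_(i < size w) i * nth 0 w i.

(** The moment drops by (q - p)(w_q - w_p), the larger letter moving to the left. *)
Lemma moment_swap (w : seq nat) (p q : nat) :
  p < q -> q < size w -> nth 0 w p < nth 0 w q ->
  moment (swap p q w) < moment w.
Proof.
move=> pq qw lt; have pw := ltn_trans pq qw.
rewrite /moment size_swap.
pose P := Ordinal pw; pose Q := Ordinal qw.
have QP : Q != P by rewrite -val_eqE /= neq_ltn pq orbT.
rewrite (bigD1 P) //= (bigD1 Q) //= [in ltnRHS](bigD1 P) //= [in ltnRHS](bigD1 Q) //=.
rewrite !addnA !nth_swap // transpL transpR.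
rewrite (eq_bigr (fun i : 'I_(size w) => i * nth 0 w i)); last first.
  move=> i /andP[/eqP iP /eqP iQ]; rewrite nth_swap // transpD //.
    by move=> e; apply/iP/val_inj.
  by move=> e; apply/iQ/val_inj.
by rewrite ltn_add2r; nia.
Qed.

Lemma raise_ind (P : seq nat -> Prop) :
  (forall w, word w ->
     (forall p q, raisable w p q -> P (swap p.+1 q w)) -> P w) ->
  forall w, word w -> P w.
Proof.
move=> step w; have [m] := ubnP (moment w); elim: m w => // m IH w lt ww.
apply: step => // p q raise; apply: IH; last exact: word_raise.
case/and5P: raise => pq qw lt1 _ _.
exact: leq_trans (moment_swap pq qw lt1) _.
Qed.

(** * Words admitting no raise *)

Section UnraisableWords.

Variables (w : seq nat) (M : nat).
Hypotheses (ww : word w) (unraisable : forall p q, ~~ raisable w p q).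
Hypotheses (Mw : M \in w) (leM : forall i, nth 0 w i <= M).
Hypothesis count_step :
  forall i, i.+1 < M -> 1 < count_mem i w -> 1 < count_mem i.+1 w.

Let f := index M w.

Let fw : f < size w. Proof. by rewrite index_mem. Qed.

Let nth_f : nth 0 w f = M. Proof. exact: nth_index. Qed.

Let ltM i : i < f -> nth 0 w i < M.
Proof.
by move=> lt; rewrite ltn_neqAle leM andbT; have /= -> := before_find 0 lt.
Qed.

(** From [t] on, some [q] is the end of a run of letters above [nth 0 w p.+1], and the pair [p], [q]
    is raisable. The bound covers all positions from [t] because this [q] is not known
    beforehand. *)
Let no_raise p t :
  p.+1 < t -> nth 0 w p.+1 < nth 0 w t ->
  (forall q, t <= q -> nth 0 w q <= (nth 0 w p).+1) -> False.
Proof.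
move=> pt /last_gt[q [tq lt le]] bnd; have /negP := unraisable p q; apply.
rewrite /raisable lt bnd // (leq_trans le) // (leq_trans pt) // !andbT /=.
by rewrite ltnNge; apply/negP => /(nth_default 0) wq; rewrite wq in lt.
Qed.

(** At [s = f] the letter is the maximum. Further on, a larger letter at [t] could be raised to [s],
    because by induction every later letter is at most the one at [s.-1]. *)
Let tail_sorted s t : f <= s -> s < t -> nth 0 w t <= nth 0 w s.
Proof.
move=> /subnKC <-; elim: (s - f) t => [|d IH] t; first by rewrite addn0 nth_f.
rewrite addnS => lt; rewrite leqNgt; apply/negP => wt.
apply: (no_raise (p := f + d) lt wt) => q tq.
by rewrite leqW // IH // (leq_trans _ tq) // ltnW.
Qed.

(** Otherwise the letter at [r] could be raised to [p.+1]: in the weakly decreasing tail nothing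
    after [r] exceeds it. *)
Let next_letter p r :
  p.+1 < f -> f <= r -> nth 0 w r = (nth 0 w p).+1 ->
  nth 0 w p.+1 = (nth 0 w p).+1.
Proof.
move=> pf fr wr; apply/eqP; rewrite eqn_leq (proj2 ww) /= ltnNge.
apply/negP => le; apply: (no_raise (p := p) (t := r)).
- exact: leq_trans fr.
- by rewrite wr ltnS.
move=> q; rewrite leq_eqVlt => /orP[/eqP<-|rq]; first by rewrite wr.
by rewrite -wr tail_sorted.
Qed.

(* Downward induction on the letter [j]: a letter [j.+1] is left in the tail,
   so by [next_letter] every [j] is followed by a [j.+1] before the tail. *)
Let no_repeat j p q :
  p < q -> q < f -> nth 0 w p = j -> nth 0 w q = j -> False.
Proof.
have [m] := ubnP (M - j); elim: m j p q => // m IH j p q ltm pq qf wp wq.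
have jM : j < M by rewrite -wq ltM.
have [r fr wr] : exists2 r, f <= r & nth 0 w r = j.+1.
  case: (ltnP j.+1 M) => j1M; last by exists f; rewrite ?nth_f //; lia.
  have /(count_mem_gt1P 0)[p' [q' [pq' qw' wp' wq']]] : 1 < count_mem j.+1 w.
    apply: count_step => //; apply/(count_mem_gt1P 0).
    by exists p, q; rewrite (ltn_trans qf).
  (* Two copies before [f] are excluded by induction, so the later copy lies in the tail. *)
  case: (leqP f q') => [fq|qf']; first by exists q'.
  by case: (IH j.+1 p' q') => //; lia.
have wp1 : nth 0 w p.+1 = j.+1.
  by rewrite -wp (next_letter _ fr) ?wp // (leq_ltn_trans pq).
have j1M : j.+1 < M by rewrite -wp1 ltM // (leq_ltn_trans pq).
(* Both copies of [j] are followed by [j.+1] before [f], a repeat excluded by induction, unless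
   [q.+1 = f]; in that case growth gives M <= j + 1. *)
case: (ltnP q.+1 f) => qf1.
  apply: (IH j.+1 p.+1 q.+1) => //; first by lia.
  by rewrite -wq (next_letter _ fr) ?wq.
have := proj2 ww q; have -> : q.+1 = f by lia.
by rewrite nth_f wq; lia.
Qed.

(** A letter smaller than [i] at position [i] already stands, by induction, at the position equal to
    it, against [no_repeat]. *)
Let prefix i : i < f -> nth 0 w i = i.
Proof.
elim/ltn_ind: i => i IH lt; apply/eqP; rewrite eqn_leq word_leq //= leqNgt.
apply/negP => wi; apply: (no_repeat wi lt _ erefl).
by apply: IH => //; apply: ltn_trans lt.
Qed.

Let f_eq : f = M.
Proof.
case: (posnP f) => [f0|f0]; first by rewrite -nth_f f0 (proj1 ww).
have ltp : f.-1 < f by rewrite prednK.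
have := ltM ltp; have := proj2 ww f.-1; rewrite prednK // nth_f prefix //; lia.
Qed.

Lemma unraisable_word : w = iota 0 M ++ drop M w /\ sorted geq (drop M w).
Proof.
have Mlt : M < size w by rewrite -f_eq.
split.
  rewrite -{1}(cat_take_drop M w); congr (_ ++ _).
  apply: (eq_from_nth (x0 := 0)); rewrite ?size_iota size_takel ?(ltnW Mlt) // => i iM.
  by rewrite nth_take // nth_iota // prefix ?f_eq.
apply/(sortedP 0) => i; rewrite size_drop => lt.
by rewrite !nth_drop /geq /= tail_sorted ?f_eq ?leq_addr // addnS.
Qed.

End UnraisableWords.

(** Beyond the common prefix [iota 0 M], both words list the same letters in decreasing order. *)
Lemma unraisable_word_unique (w1 w2 : seq nat) (M : nat) :
  word w1 -> word w2 -> perm_eq w1 w2 ->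
  (forall p q, ~~ raisable w1 p q) -> (forall p q, ~~ raisable w2 p q) ->
  M \in w1 -> (forall i, nth 0 w1 i <= M) -> (forall i, nth 0 w2 i <= M) ->
  (forall i, i.+1 < M -> 1 < count_mem i w1 -> 1 < count_mem i.+1 w1) ->
  w1 = w2.
Proof.
move=> ww1 ww2 p12 n1 n2 Mw le1 le2 st.
have [e1 s1] := unraisable_word ww1 n1 Mw le1 st.
have [||e2 s2] := unraisable_word ww2 n2 _ le2.
- by rewrite -(perm_mem p12).
- by move=> i iM; rewrite -!(permP p12); apply: st.
rewrite e1 e2; congr (_ ++ _); apply: (sorted_eq (leT := geq)) => //.
- by move=> y x z /= yx zy; apply: leq_trans yx.
- by move=> x y /=; rewrite andbC -eqn_leq => /eqP.
by move: p12; rewrite {1}e1 {1}e2 perm_cat2l.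
Qed.

(* The letters larger than the unique [c] form an interval that starts right
   after it, so [c] cannot jump over them. *)
Lemma unique_letter_not_lt (w1 w2 : seq nat) (c i j t1 t2 s : nat) :
  word w1 -> word w2 ->
  (forall t, nth 0 w1 t = c <-> t = t1) ->
  (forall t, nth 0 w2 t = c <-> t = t2) ->
  c < nth 0 w2 s ->
  nth 0 w1 i = nth 0 w2 j -> nth 0 w1 j = nth 0 w2 i ->
  (forall l, l != i -> l != j -> nth 0 w1 l = nth 0 w2 l) ->
  ~ t1 < t2.
Proof.
move=> ww1 ww2 c1 c2 cs wij wji wl lt12.
have ij t : nth 0 w1 t <> nth 0 w2 t -> t = i \/ t = j.
  move=> ne; case: (t =P i) => [|/eqP ti]; first by left.
  by case: (t =P j) => [|/eqP tj]; [right|case: ne; apply: wl].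
have ne : t1 <> t2 by lia.
(* Both [t1] and [t2] change their letter, so they are the two exchanged positions. *)
have ij1 : t1 = i \/ t1 = j.
  by apply: ij; rewrite (proj2 (c1 t1) erefl) => /esym/c2.
have ij2 : t2 = i \/ t2 = j.
  by apply: ij; rewrite (proj2 (c2 t2) erefl) => /c1/esym.
have w21 : nth 0 w2 t1 = nth 0 w1 t2 by case: ij1 => e1; case: ij2 => e2; subst.
(* In [w2] the last [c] before [s] is at [t2], so [s] lies beyond both positions and keeps its
   letter. *)
have [u [us /c2 eu ur]] := word_last_visit ww2 cs; subst u.
have ne2 : s <> t2 by lia.
have ne1 : s <> t1 by lia.
have cs1 : c < nth 0 w1 s.
  by rewrite wl //; apply/eqP => e; subst s; case: ij1 ij2 => ? [] ?; subst; lia.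
have [v [vs /c1 ev vr]] := word_last_visit ww1 cs1; subst v.
(* In [w1] all letters after [t1] up to [s] exceed [c], in particular the one at [t2], which [w2]
   carries at [t1]; so [w2] must visit [c] before [t1]. *)
have c21 : c < nth 0 w2 t1 by rewrite w21 vr // lt12 ltnW.
by have [x [xt /c2 ex _]] := word_last_visit ww2 c21; lia.
Qed.

Lemma unique_letter_fixed (w1 w2 : seq nat) (c i j t1 t2 s1 s2 : nat) :
  word w1 -> word w2 ->
  (forall t, nth 0 w1 t = c <-> t = t1) ->
  (forall t, nth 0 w2 t = c <-> t = t2) ->
  c < nth 0 w1 s1 -> c < nth 0 w2 s2 ->
  nth 0 w1 i = nth 0 w2 j -> nth 0 w1 j = nth 0 w2 i ->
  (forall l, l != i -> l != j -> nth 0 w1 l = nth 0 w2 l) ->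
  t1 = t2.
Proof.
move=> ww1 ww2 c1 c2 cs1 cs2 wij wji wl.
have n12 := unique_letter_not_lt ww1 ww2 c1 c2 cs2 wij wji wl.
have n21 := unique_letter_not_lt ww2 ww1 c2 c1 cs1 (esym wji) (esym wij)
  (fun l li lj => esym (wl l li lj)).
by lia.
Qed.

(** The leftover letters are appended in weakly decreasing order; none exceeds the last letter [M]
    of [A], so growth persists. *)
Lemma word_extend (A z : seq nat) (M : nat) :
  word A -> 0 < size A -> last 0 A = M -> {in z, forall x, x <= M} ->
  (forall x, count_mem x A <= count_mem x z) ->
  exists2 D, word (A ++ D) & perm_eq (A ++ D) z.
Proof.
move=> [A0 AS] sA lA leM /count_subseqP[s /perm_to_subseq[D zD] As].
exists (sort geq D); last first.
  rewrite perm_sym (perm_trans zD) // perm_sym.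
  by apply: perm_cat; rewrite ?perm_sort.
set E := sort geq D.
have sE : sorted geq E by apply: sort_sorted => x y /=; apply: leq_total.
have leE i : nth 0 E i <= M.
  case: (ltnP i (size E)) => iE; last by rewrite nth_default.
  by apply: leM; rewrite (perm_mem zD) mem_cat -(mem_sort geq D) mem_nth ?orbT.
split=> [|i]; first by rewrite nth_cat sA.
rewrite !nth_cat; have [iA|iA|iA] := ltngtP i.+1 (size A).
- exact: AS.
- rewrite subSn; last by lia.
  case: (ltnP (i - size A).+1 (size E)) => iE; last by rewrite [nth 0 E _]nth_default.
  by apply: leqW; have /(sortedP 0)/(_ _ iE) := sE.
by rewrite -iA subnn (leq_trans (leE 0)) // leqW // -lA -nth_last -iA.
Qed.

(** * Boards and words *)

(** Inverse to [root_vector]: on words the truncated subtraction is exact by [word_leq]. *)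
Definition heights (w : seq nat) : seq nat :=
  mkseq (fun i => i - nth 0 w i) (size w).

Definition board (w : seq nat) : seq nat := [seq x <- heights w | 0 < x].

Lemma size_heights (w : seq nat) : size (heights w) = size w.
Proof. exact: size_mkseq. Qed.

Lemma ferrers_heights (w : seq nat) : word w -> ferrers (heights w).
Proof.
move=> [_ wS]; apply/(sortedP 0) => i; rewrite size_heights => lt.
by rewrite !nth_mkseq ?(ltnW lt) //; have := wS i; lia.
Qed.

Lemma size_pad (n : nat) (b : seq nat) : size b <= n -> size (pad n b) = n.
Proof. by move=> le; rewrite size_cat size_nseq subnK. Qed.

Lemma ferrers_pad (n : nat) (b : seq nat) : ferrers b -> ferrers (pad n b).
Proof. exact: ferrers_nseq0. Qed.

Lemma pad_filter (b : seq nat) :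
  ferrers b -> pad (size b) [seq x <- b | 0 < x] = b.
Proof.
elim: b => //= x b IH fb; have fb' : ferrers b := path_sorted fb.
case: x fb => [|x] fb /=.
  rewrite -[X in _ = _ :: X](IH fb') /pad subSn ?size_filter ?count_size //.
have all_pos : all (fun y => 0 < y) b.
  by apply/allP => y /(allP (order_path_min leq_trans fb)); apply: leq_trans.
by rewrite (all_filterP all_pos) /pad subnn.
Qed.

Lemma filter_pad (n : nat) (b : seq nat) :
  canonical b -> [seq x <- pad n b | 0 < x] = b.
Proof.
move=> /andP[_ /all_filterP eb]; rewrite /pad filter_cat eb.
by elim: (n - size b).
Qed.

Lemma canonical_board (w : seq nat) : word w -> canonical (board w).
Proof.
move=> ww; rewrite /canonical filter_all andbT.
by apply: (subseq_sorted leq_trans (filter_subseq _ _)); apply: ferrers_heights.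
Qed.

Lemma pad_board (w : seq nat) : word w -> pad (size w) (board w) = heights w.
Proof.
by move=> ww; rewrite -{1}(size_heights w) pad_filter //; apply: ferrers_heights.
Qed.

Lemma root_vector_heights (w : seq nat) :
  word w -> root_vector (heights w) = map Posz w.
Proof.
move=> ww; apply: (eq_from_nth (x0 := 0%R)).
  by rewrite size_root_vector size_heights size_map.
move=> i; rewrite size_root_vector => ih; rewrite nth_root_vector //.
move: ih; rewrite size_heights => iw.
rewrite nth_mkseq // (nth_map 0) //.
by have := word_leq i ww; lia.
Qed.

(** Weakly increasing heights amount to the growth condition on roots. *)
Lemma word_of_root_vector (b : seq nat) :
  ferrers b -> {in root_vector b, forall z, 0 <= z}%R ->
  exists w, [/\ word w, map Posz w = root_vector b & heights w = b].
Proof.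
move=> fb rb; pose w := mkseq (fun i => i - nth 0 b i) (size b).
have le i : i < size b -> nth 0 b i <= i.
  move=> ib; have := rb (nth 0 (root_vector b) i)%R.
  by rewrite mem_nth ?size_root_vector // nth_root_vector // => /(_ isT); lia.
have ww : word w.
  split=> [|i].
    by case: (posnP (size b)) => s0; [rewrite nth_default ?size_mkseq ?s0|rewrite nth_mkseq].
  case: (ltnP i.+1 (size b)) => ib; last by rewrite nth_default ?size_mkseq.
  rewrite !nth_mkseq ?(ltnW ib) //; have /(sortedP 0)/(_ i ib) := fb.
  by have := le i (ltnW ib); lia.
have hw : heights w = b.
  apply: (eq_from_nth (x0 := 0)); rewrite size_heights size_mkseq // => i ib.
  by rewrite nth_mkseq ?size_mkseq // nth_mkseq // subKn // le.
by exists w; rewrite -root_vector_heights // hw.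
Qed.

Lemma rook_equiv_nseq0 (m : nat) (b1 b2 : seq nat) :
  ferrers b1 -> rook_equiv b1 b2 -> rook_equiv (nseq m 0 ++ b1) b2.
Proof. by move=> f1 eqv k; rewrite rook_number_nseq0. Qed.

Lemma rook_equivC (b1 b2 : seq nat) : rook_equiv b1 b2 -> rook_equiv b2 b1.
Proof. by move=> eqv k. Qed.

(** Were [c] longer, padding [B] to its size would keep all roots non-negative, whereas the first
    root of [c] is minus its positive first height. *)
Lemma size_GB_vertex (B c : seq nat) :
  ferrers B -> {in root_vector B, forall z, 0 <= z}%R ->
  GB_vertex B c -> size c <= size B.
Proof.
move=> fB rB [/andP[fc pc] eqv]; rewrite leqNgt; apply/negP => lt.
have sN : size (pad (size c) B) = size c by rewrite size_pad // ltnW.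
have /rook_equivC eqv' := rook_equiv_nseq0 (size c - size B) fB (rook_equivC eqv).
have fN := ferrers_pad (size c) fB.
have /perm_mem/(_ (nth 0 (root_vector c) 0)%R) :=
  proj1 (rook_equiv_root_vector fc fN (esym sN)) eqv'.
have c0 : 0 < size c by lia.
rewrite mem_nth ?size_root_vector // => /esym/(nthP 0%R)[i].
rewrite size_root_vector sN => ic; rewrite !nth_root_vector ?sN //.
have c_gt0 : 0 < nth 0 c 0 by apply: (allP pc); apply: mem_nth.
rewrite /pad nth_cat size_nseq nth_nseq; case: ltnP => iN; first by lia.
have iB : i - (size c - size B) < size B by lia.
have := rB (nth 0 (root_vector B) (i - (size c - size B)))%R.
by rewrite mem_nth ?size_root_vector // nth_root_vector // => /(_ isT); lia.
Qed.

(** A vertex fits into [size B] columns; padded to that size, it has the roots of [B] in another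
    order, which form a word. *)
Lemma GB_vertexP (B c : seq nat) :
  ferrers B -> {in root_vector B, forall z, 0 <= z}%R ->
  GB_vertex B c <->
  exists w, [/\ word w, perm_eq (map Posz w) (root_vector B) & c = board w].
Proof.
move=> fB rB; split=> [vc|[w [ww pw ->]]]; last first.
  have sw : size w = size B by rewrite -(size_map Posz) (perm_size pw) size_root_vector.
  split; first exact: canonical_board.
  rewrite -root_vector_heights // in pw; have fh := ferrers_heights ww.
  have sh : size (heights w) = size B by rewrite size_heights.
  move=> k; rewrite -(proj2 (rook_equiv_root_vector fh fB sh) pw k) -pad_board //.
  rewrite rook_number_nseq0 //.
  by have /andP[] := canonical_board ww.
have sc := size_GB_vertex fB rB vc; case: vc => cc eqv.
have /andP[fc _] := cc; have fp := ferrers_pad (size B) fc.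
have pr := proj1 (rook_equiv_root_vector fp fB (size_pad sc))
  (rook_equiv_nseq0 _ fc eqv).
have [|w [ww rw hw]] := word_of_root_vector fp.
  by move=> z; rewrite (perm_mem pr); apply: rB.
by exists w; split; rewrite ?rw // /board hw filter_pad.
Qed.

(** * Edges as transpositions of letters *)

(** The relation inside [rook_edge] with the number of columns left free, so that boards can be
    compared at the size of their words. *)
Definition cell_move (N : nat) (p1 p2 : seq nat) : Prop :=
  exists i j k : nat,
    [/\ i < N, j < N, i != j, 0 < k &
     [/\ nth 0 p1 i = nth 0 p2 i + k, nth 0 p1 j + k = nth 0 p2 j &
         forall l, l < N -> l != i -> l != j -> nth 0 p1 l = nth 0 p2 l]].

Lemma cell_move_nseq0 (d N : nat) (p1 p2 : seq nat) :
  cell_move (d + N) (nseq d 0 ++ p1) (nseq d 0 ++ p2) <-> cell_move N p1 p2.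
Proof.
have nth0 p i : nth 0 (nseq d 0 ++ p) i = if i < d then 0 else nth 0 p (i - d).
  by rewrite nth_cat size_nseq nth_nseq; case: ltnP.
have ge l : (d + l < d) = false by lia.
split=> [] [i [j [k [iN jN ij k0 [h1 h2 h3]]]]].
  (* Columns below [d] are empty on both sides, which [0 < k] rules out for [i] and [j]. *)
  move: h1 h2; rewrite !nth0; case: ltnP => di; first by lia.
  case: ltnP => dj; first by lia.
  move=> h1 h2; exists (i - d), (j - d), k; split=> //; try lia.
  split=> // l lN li lj; have := h3 (d + l).
  by rewrite !nth0 ge addKn; apply; lia.
exists (d + i), (d + j), k; split=> //; try lia.
split=> [||l lN li lj]; rewrite !nth0 ?ge ?addKn //.
by case: ltnP => // dl; apply: h3; lia.
Qed.

Lemma rook_edgeE (n : nat) (b1 b2 : seq nat) :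
  size b1 <= n -> size b2 <= n ->
  rook_edge b1 b2 <-> cell_move n (pad n b1) (pad n b2).
Proof.
move=> le1 le2; set N := maxn (size b1) (size b2).
have padE b : size b <= N -> pad n b = nseq (n - N) 0 ++ pad N b.
  move=> le; rewrite /pad catA -nseqD; congr (nseq _ _ ++ _).
  by rewrite /N in le *; lia.
rewrite !padE ?leq_maxl ?leq_maxr // -[X in cell_move X](_ : n - N + N = n); last first.
  by rewrite /N; lia.
by rewrite cell_move_nseq0.
Qed.

Lemma rook_edge_sym (b1 b2 : seq nat) : rook_edge b1 b2 -> rook_edge b2 b1.
Proof.
move=> [i [j [k []]]]; rewrite maxnC => iN jN ij k0 [h1 h2 h3].
exists j, i, k; split=> //; first by rewrite eq_sym.
by split=> // l lN lj li; rewrite h3.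
Qed.

Lemma rook_edge_board (w1 w2 : seq nat) :
  word w1 -> word w2 -> size w1 = size w2 ->
  rook_edge (board w1) (board w2) <->
  cell_move (size w1) (heights w1) (heights w2).
Proof.
have size_board w : size (board w) <= size w.
  by rewrite size_filter -(size_heights w) count_size.
move=> ww1 ww2 s12; rewrite (rook_edgeE (n := size w1)) //; last by rewrite s12.
by rewrite (pad_board ww1) s12 (pad_board ww2).
Qed.

Lemma rook_edge_raise (w : seq nat) (p q : nat) :
  word w -> raisable w p q -> rook_edge (board w) (board (swap p.+1 q w)).
Proof.
move=> ww raise; have ww' := word_raise ww raise.
case/and5P: raise => pq qw lt1 _ _; have pw := ltn_trans pq qw.
apply/rook_edge_board; rewrite ?size_swap //.
have le i := word_leq i ww; have le' i := word_leq i ww'.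
exists p.+1, q, (nth 0 w q - nth 0 w p.+1).
have hp := le' p.+1; rewrite nth_swap // transpL in hp.
split=> //; try lia; split=> [||l lw /eqP lp /eqP lq];
  rewrite !nth_mkseq ?size_swap //.
- by rewrite transpL; lia.
- by rewrite transpR; have := le q; lia.
by rewrite transpD.
Qed.

(** An edge adds [k] to one letter and subtracts [k] from another; as the multiset of letters is the
    same, the two letters must be exchanged. *)
Lemma rook_edge_swap (w1 w2 : seq nat) :
  word w1 -> word w2 -> perm_eq w1 w2 -> rook_edge (board w1) (board w2) ->
  exists i j, [/\ nth 0 w1 i = nth 0 w2 j, nth 0 w1 j = nth 0 w2 i &
    forall l, l != i -> l != j -> nth 0 w1 l = nth 0 w2 l].
Proof.
move=> ww1 ww2 p12; have s12 := perm_size p12.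
move=> /(rook_edge_board ww1 ww2 s12) [i [j [k [iN jN ij k0 [h1 h2 h3]]]]].
have hE w l : word w -> l < size w -> nth 0 (heights w) l + nth 0 w l = l.
  by move=> ww lw; rewrite nth_mkseq // subnK // word_leq.
have hi1 := hE w1 i ww1 iN; have hj1 := hE w1 j ww1 jN.
have hi2 := hE w2 i ww2; have hj2 := hE w2 j ww2; rewrite -s12 in hi2 hj2.
have {}hi2 := hi2 iN; have {}hj2 := hj2 jN.
have wi : nth 0 w2 i = nth 0 w1 i + k by lia.
have wj : nth 0 w1 j = nth 0 w2 j + k by lia.
have wl l : l != i -> l != j -> nth 0 w1 l = nth 0 w2 l.
  move=> li lj; case: (ltnP l (size w1)) => lw; last first.
    by rewrite !nth_default -?s12.
  have := h3 l lw li lj; have := hE w1 l ww1 lw; have := hE w2 l ww2.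
  by rewrite -s12 => /(_ lw); lia.
suff e : nth 0 w2 j = nth 0 w1 i by exists i, j; split=> //; lia.
(* Occurrences of [a] are counted at [i], at [j] and elsewhere: [w2] loses the one at [i], so it
   must have [a] at [j]. *)
pose a := nth 0 w1 i; have cE w : size w = size w1 -> count_mem a w =
    (nth 0 w i == a) + ((nth 0 w j == a) +
      \sum_(l < size w1 | (l != Ordinal iN) && (l != Ordinal jN)) (nth 0 w l == a)).
  move=> sw; rewrite -{1}(mkseq_nth 0 w) /mkseq count_map -sum1_count sw.
  have -> : iota 0 (size w1) = index_iota 0 (size w1) by rewrite /index_iota subn0.
  rewrite big_mkord big_mkcond /=.
  rewrite (bigD1 (Ordinal iN)) //= (bigD1 (Ordinal jN)) //=.
  by rewrite -val_eqE /= eq_sym.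
have := permP p12 (pred1 a); rewrite !cE //.
rewrite (eq_bigr (fun l : 'I_(size w1) => nat_of_bool (nth 0 w2 l == a))); last first.
  by move=> l /andP[li lj]; rewrite wl.
rewrite eqxx wi /a; case: (nth 0 w2 j =P nth 0 w1 i) => // _.
have -> : (nth 0 w1 i + k == nth 0 w1 i) = false by lia.
by move: (\sum_(_ < _ | _) _) => S; lia.
Qed.

(** * Connectedness *)

Definition root_word (B w : seq nat) : Prop :=
  word w /\ perm_eq (map Posz w) (root_vector B).

Definition GB_step (B x y : seq nat) : Prop :=
  [/\ GB_vertex B x, GB_vertex B y & rook_edge x y].

Lemma root_word_perm (B w1 w2 : seq nat) :
  root_word B w1 -> root_word B w2 -> perm_eq w1 w2.
Proof.
move=> [_ p1] [_ p2]; have injZ : injective Posz by move=> x y [].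
by apply: (perm_map_inj injZ); rewrite (perm_trans p1) // perm_sym.
Qed.

Lemma root_mult_word (B w : seq nat) (k : nat) :
  root_word B w -> root_mult B k = count_mem k w.
Proof. by move=> [_ pw]; rewrite /root_mult -(permP pw) count_map; apply: eq_count. Qed.

Lemma root_word_raise (B w : seq nat) (p q : nat) :
  root_word B w -> raisable w p q -> root_word B (swap p.+1 q w).
Proof.
move=> [ww pw] raise; split; first exact: word_raise.
have /and5P[pq qw _ _ _] := raise.
by rewrite (perm_trans _ pw) // perm_map // perm_swap // (ltn_trans pq).
Qed.

(** Repeated raising. Both directions are recorded because the path relation is directed: one path
    leads to the raise-free board, the other away from it. *)
Lemma connect_unraisable (B w : seq nat) :
  ferrers B -> {in root_vector B, forall z, 0 <= z}%R -> root_word B w ->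
  exists w', [/\ root_word B w', forall p q, ~~ raisable w' p q,
    clos_refl_trans _ (GB_step B) (board w) (board w') &
    clos_refl_trans _ (GB_step B) (board w') (board w)].
Proof.
move=> fB rB Bw; have [ww _] := Bw; elim/raise_ind: w / ww Bw => w ww IH Bw.
case: (boolP [exists p : 'I_(size w), exists q : 'I_(size w), raisable w p q]).
  move=> /existsP[p /existsP[q raise]].
  have Bw' := root_word_raise Bw raise.
  have [w' [Bw'' nr c1 c2]] := IH p q raise Bw'.
  have vertex u : root_word B u -> GB_vertex B (board u).
    by move=> [wu pu]; apply/GB_vertexP => //; exists u.
  have edge := rook_edge_raise ww raise.
  exists w'; split=> //; first by apply: rt_trans c1; apply: rt_step; split=> //; apply: vertex.
  by apply: rt_trans c2 _; apply: rt_step; split; [exact: vertex..|exact: rook_edge_sym].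
rewrite negb_exists => /forallP nr; exists w; split=> //; try exact: rt_refl.
move=> p q; apply/negP => raise; have /and5P[pq qw _ _ _] := raise.
have pw : p < size w by apply: ltn_trans qw; apply: ltnW.
have := nr (Ordinal pw); rewrite negb_exists => /forallP/(_ (Ordinal qw)).
by rewrite raise.
Qed.

(** * The position of a unique letter as an invariant *)

(** [0 < c] separates [c] from the default letter read past the end. *)
Lemma nth_unique_letter (w : seq nat) (c t : nat) :
  0 < c -> count_mem c w = 1 -> nth 0 w t = c <-> t = index c w.
Proof.
move=> c0 cw; have cm : c \in w by rewrite -has_pred1 has_count cw.
split=> [wt|->]; last exact: nth_index.
have tw : t < size w.
  by rewrite ltnNge; apply/negP => /(nth_default 0) e; rewrite e in wt; rewrite -wt in c0.
have [lt|lt|//] := ltngtP t (index c w).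
  by have := before_find 0 lt; rewrite /= wt eqxx.
suff : 1 < count_mem c w by rewrite cw.
by apply/(count_mem_gt1P 0); exists (index c w), t; rewrite nth_index.
Qed.

Lemma count_mem_iota (x m n : nat) :
  count_mem x (iota m n) = (m <= x < m + n).
Proof. by rewrite count_uniq_mem ?iota_uniq // mem_iota. Qed.

(** Read off from the board rather than the word, so that it can be followed along paths of G(B). *)
Definition letter_index (B : seq nat) (c : nat) (x : seq nat) : nat :=
  index c (map absz (root_vector (pad (size B) x))).

Lemma letter_index_board (B : seq nat) (c : nat) (w : seq nat) :
  root_word B w -> letter_index B c (board w) = index c w.
Proof.
move=> [ww pw]; have sB : size w = size B.
  by rewrite -(size_map Posz) (perm_size pw) size_root_vector.
by rewrite /letter_index -sB pad_board // root_vector_heights // -map_comp map_id.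
Qed.

(** The root [M] above [c] puts a larger letter into every word, as [unique_letter_fixed]
    demands. *)
Lemma letter_index_connected (B : seq nat) (c : nat) (M : int) (x y : seq nat) :
  ferrers B -> {in root_vector B, forall z, 0 <= z}%R ->
  0 < c -> root_mult B c = 1 -> (c%:Z < M)%R -> M \in root_vector B ->
  clos_refl_trans _ (GB_step B) x y ->
  letter_index B c x = letter_index B c y.
Proof.
move=> fB rB c0 c1 cM BM; elim=> {x y} [x y|//|x y z _ -> _ -> //].
move=> [/(GB_vertexP x fB rB)[w1 [ww1 p1 ->]] /(GB_vertexP y fB rB)[w2 [ww2 p2 ->]]].
have B1 : root_word B w1 by []; have B2 : root_word B w2 by [].
move=> /(rook_edge_swap ww1 ww2 (root_word_perm B1 B2)) [i [j [wij wji wl]]].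
rewrite !letter_index_board //.
have large w : root_word B w -> exists s, c < nth 0 w s.
  move=> [_ pw]; have := BM; rewrite -(perm_mem pw) => /mapP[m mw defM].
  by exists (index m w); rewrite nth_index // -ltz_nat -defM.
have [s1 cs1] := large w1 B1; have [s2 cs2] := large w2 B2.
have uniq1 t := @nth_unique_letter w1 c t c0 (etrans (esym (root_mult_word c B1)) c1).
have uniq2 t := @nth_unique_letter w2 c t c0 (etrans (esym (root_mult_word c B2)) c1).
exact: unique_letter_fixed ww1 ww2 uniq1 uniq2 cs1 cs2 wij wji wl.
Qed.

Theorem theorem10 (B : seq nat) (M : int) :
  ferrers B ->
  (forall z, z \in root_vector B -> (0 <= z)%R) ->
  (0 < root_mult B M)%N ->
  (forall k : int, (0 < root_mult B k)%N -> (k <= M)%R) ->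
  (GB_connected B <->
   forall i : int, (0 <= i)%R -> (i < M - 1)%R ->
     (1 < root_mult B i)%N -> (1 < root_mult B (i + 1))%N).
Proof.
move=> fB rB; rewrite -has_count has_pred1 => BM leM.
have [w0 [ww0 rw0 _]] := word_of_root_vector fB rB.
have B0 : root_word B w0 by split; rewrite ?rw0.
have multE k w : root_word B w -> count_mem k w = root_mult B k.
  by move=> Bw; rewrite (root_mult_word k Bw).
have [m defM] : exists m, M = Posz m.
  by have := rB M BM; case: M {BM leM} => // m _; exists m.
have mem_m w : root_word B w -> m \in w.
  by move=> [_ pw]; have := BM; rewrite -(perm_mem pw) defM => /mapP[x xw [->]].
have le_m w x : root_word B w -> x \in w -> x <= m.
  move=> Bw xw; rewrite -lez_nat -defM leM // -(multE x w Bw).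
  by rewrite -has_count has_pred1.
have GBP x : GB_vertex B x <-> exists w, root_word B w /\ x = board w.
  rewrite GB_vertexP //; split=> [[w [ww pw ->]]|[w [[ww pw] ->]]]; first by exists w.
  by exists w.
split=> [conn i|step x y].
- case: i => // n _; rewrite defM => ltn; have {ltn} n1m : n.+1 < m by lia.
  have -> : (n%:Z + 1)%R = n.+1 by lia.
  rewrite -!(multE _ w0) // => cn; rewrite ltnNge; apply/negP => cn1.
  (* Words skip no value, so every letter up to [m] occurs; hence [n.+1] occurs exactly once. *)
  have mem0 x : x <= m -> 0 < count_mem x w0.
    by move=> xm; rewrite -has_count has_pred1 (word_mem_leq ww0 (mem_m w0 B0) xm).
  have c1 w : root_word B w -> count_mem n.+1 w = 1.
    by move=> Bw; rewrite multE // -(multE _ w0) //; have := mem0 n.+1; lia.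
  have extend A : word A -> 0 < size A -> last 0 A = m ->
      (forall x, count_mem x A <= count_mem x w0) ->
      exists D, root_word B (A ++ D).
    move=> wA sA lA cA; have le0 : {in w0, forall x, x <= m} by move=> x; apply: le_m.
    have [D wD pD] := word_extend wA sA lA le0 cA.
    by exists D; split=> //; rewrite -rw0 perm_map.
  (* The first word begins 0 1 ... m and has [n.+1] at position [n.+1]. *)
  have [||||D1 B1] := extend (iota 0 m.+1).
  + split=> // k; case: (ltnP k.+1 m.+1) => km.
      by rewrite !nth_iota // ltnW.
    by rewrite nth_default ?size_iota.
  + by rewrite size_iota.
  + by rewrite -nth_last size_iota nth_iota.
  + move=> x; rewrite count_mem_iota.
    by case: (leqP x m) => xm; [have := mem0 x xm|]; lia.
  (* The second word repeats [n], as [cn] permits, which shifts the unique [n.+1] to position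
     [n.+2]. *)
  have [||||D2 B2] := extend (iota 0 n.+1 ++ iota n (m.+1 - n)).
  + split=> // k; rewrite !nth_cat size_iota.
    case: (ltnP k.+1 n.+1) => kn; first by rewrite (ltnW kn) !nth_iota // ltnW.
    case: (ltnP (k.+1 - n.+1) (m.+1 - n)) => km; last first.
      by rewrite [nth 0 (iota n _) _]nth_default ?size_iota.
    rewrite nth_iota //; case: ltnP => kn'; rewrite nth_iota //; by lia.
  + by rewrite size_cat size_iota.
  + by rewrite last_cat -nth_last size_iota nth_iota; lia.
  + move=> x; rewrite count_cat !count_mem_iota.
    case: (x =P n) => [->|xn]; first by rewrite (leq_trans _ cn) //; lia.
    by case: (leqP x m) => xm; [have := mem0 x xm|]; lia.
  have B1v : GB_vertex B (board (iota 0 m.+1 ++ D1)) by apply/GBP; eexists; split; [exact: B1|].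
  have B2v : GB_vertex B (board (iota 0 n.+1 ++ iota n (m.+1 - n) ++ D2)).
    by apply/GBP; rewrite catA; eexists; split; [exact: B2|].
  have n1M : (n.+1%:Z < M)%R by rewrite defM ltz_nat.
  have r1 : root_mult B n.+1 = 1 by rewrite -(multE _ w0) // c1.
  have := letter_index_connected fB rB (ltn0Sn n) r1 n1M BM (conn _ _ B1v B2v).
  rewrite catA !letter_index_board //.
  have <- : n.+1 = index n.+1 (iota 0 m.+1 ++ D1).
    apply/nth_unique_letter => //; first exact: c1.
    by rewrite nth_cat size_iota ltnW // nth_iota // ltnW.
  have <- : n.+2 = index n.+1 ((iota 0 n.+1 ++ iota n (m.+1 - n)) ++ D2).
    apply/nth_unique_letter => //; first exact: c1.
    rewrite nth_cat size_cat !size_iota nth_cat size_iota.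
    have -> : n.+2 < n.+1 + (m.+1 - n) by lia.
    by rewrite ltnNge leqnSn /= nth_iota; lia.
  by lia.
move=> /GBP[w1 [B1 ->]] /GBP[w2 [B2 ->]].
have [u1 [Bu1 nr1 c1 _]] := connect_unraisable fB rB B1.
have [u2 [Bu2 nr2 _ c2]] := connect_unraisable fB rB B2.
(* The two paths join once the raise-free words at their ends coincide. *)
suff e : u1 = u2 by apply: rt_trans c1 _; rewrite e.
have le_nth u i : root_word B u -> nth 0 u i <= m.
  move=> Bu; case: (ltnP i (size u)) => iu; last by rewrite nth_default.
  by apply: (le_m u) => //; apply: mem_nth.
apply: (unraisable_word_unique (M := m)) => //; try by case: Bu1; case: Bu2.
- exact: root_word_perm Bu1 Bu2.
- exact: mem_m.
- by move=> i; apply: le_nth.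
- by move=> i; apply: le_nth.
move=> i im; rewrite !multE // => ci.
have -> : Posz i.+1 = (i%:Z + 1)%R by lia.
by apply: step => //; lia.
Qed.
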